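(* Let $p$ be a prime and let $G$ be a finite abelian $p$-group with $|G|>1$, of exponent $p^\ell$. Then $$\mathcal{C}(G)=\begin{cases}\varphi(p^\ell)=p^\ell-p^{\ell-1}, & \text{if }G\text{ is cyclic},\\[3pt] p^\ell-1, & \text{if }G\text{ is noncyclic}.\end{cases}$$
   Context: For an element $x$ of a finite group $G$, $\operatorname{ord}(x)$ denotes its order. A nonempty subset $S\subseteq G$ is called a Chowla set if $\operatorname{ord}(x)>|S|$ for every $x\in S$. Define $\mathcal{C}(G)=\max\{|S|:S\subseteq G\text{ is a Chowla set}\}$. $\varphi$ is Euler's totient function. *)

(* Defs.v *)
From mathcomp Require Import all_boot all_fingroup all_solvable.

Set Implicit Arguments.
Unset Strict Implicit.
Unset Printing Implicit Defensive.

Definition chowla_set (gT : finGroupType) (G S : {set gT}) : bool :=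
  [&& S != set0, S \subset G & [forall x in S, #|S| < #[x]%g]].

(* A maximum over an empty family is 0; this happens only for trivial G, since
   a singleton of a nontrivial element is a Chowla set. *)
Definition chowla_number (gT : finGroupType) (G : {set gT}) : nat :=
  \max_(S : {set gT} | chowla_set G S) #|S|.

(* Main.v *)
Require Import Defs.
From mathcomp Require Import all_boot all_fingroup all_solvable.

Set Implicit Arguments.
Unset Strict Implicit.
Unset Printing Implicit Defensive.

(** Every Chowla set of [G] has fewer elements than the exponent [p ^ l] of [G],
    and every nonempty set of fewer than [p ^ l] elements of order [p ^ l] is a
    Chowla set. So everything depends on how many elements of maximal order
    [G] has.

    If [G] is not cyclic, they are plentiful. For [a] of order [p ^ l] and [x]
    of smaller order, [x] is killed by [p ^ (l - 1)] while [a] is not, so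
    [x * a] has order [p ^ l] again: translation by [a] injects the elements of
    smaller order into those of maximal order, which therefore make up at least
    half of [G] ([leq_card_max_order]). As [p ^ l] is a proper divisor of
    [#|G|], this half has at least [p ^ l] elements, and any [p ^ l - 1] of them
    form a Chowla set meeting the upper bound.

    If [G] is cyclic, the elements of maximal order are the [totient (p ^ l)]
    generators, and they form a Chowla set. A larger set contains a
    non-generator, whose order is at most
    [p ^ (l - 1) <= (p - 1) * p ^ (l - 1) = totient (p ^ l)], so it is not a
    Chowla set. *)

Definition max_order_elements (gT : finGroupType) (G : {set gT}) : {set gT} :=
  [set x in G | #[x]%g == exponent G].

Lemma subset_of_card (T : finType) (A : {set T}) (n : nat) :
  n <= #|A| -> exists2 B : {set T}, B \subset A & #|B| = n.
Proof.
move=> /card_geqP[s [s_uniq s_size sA]]; exists [set x in s].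
  by apply/subsetP=> x; rewrite inE => /sA.
by rewrite cardsE (card_uniqP s_uniq).
Qed.

Lemma dvdn_pfactor_pred (p l d : nat) :
  prime p -> d %| p ^ l -> d != p ^ l -> d %| p ^ l.-1.
Proof.
move=> p_prime /(dvdn_pfactor _ _ p_prime)[m m_le ->] m_neq.
apply: dvdn_exp2l; case: l m_le m_neq => [|l] /=.
  by rewrite leqn0 => ->.
by rewrite leq_eqVlt => /orP[/eqP->|//]; rewrite eqxx.
Qed.

Lemma leq_pfactor_pred_totient (p l : nat) :
  prime p -> 0 < l -> p ^ l.-1 <= totient (p ^ l).
Proof.
move=> p_prime l_gt0; rewrite totient_pfactor // leq_pmull //.
by rewrite -subn1 subn_gt0 prime_gt1.
Qed.

Lemma totient_pfactor_sub (p l : nat) :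
  prime p -> 0 < l -> totient (p ^ l) = p ^ l - p ^ l.-1.
Proof.
move=> p_prime l_gt0; rewrite totient_pfactor //.
by rewrite -subn1 mulnBl mul1n -expnS prednK.
Qed.

Section ChowlaBounds.

Variables (gT : finGroupType) (G : {group gT}).

Lemma chowla_set_ltn_exponent (S : {set gT}) :
  chowla_set G S -> #|S| < exponent G.
Proof.
case/and3P=> /set0Pn[x xS] /subsetP SG /forall_inP ordS.
apply: leq_trans (ordS x xS) _.
by rewrite dvdn_leq ?exponent_gt0 ?dvdn_exponent ?SG.
Qed.

Lemma chowla_number_ge (S : {set gT}) :
  chowla_set G S -> #|S| <= chowla_number G.
Proof. exact: (leq_bigmax_cond (P := chowla_set G) (F := fun S => #|S|) S). Qed.

Lemma chowla_set_max_order (S : {set gT}) :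
  S \subset max_order_elements G -> 0 < #|S| < exponent G -> chowla_set G S.
Proof.
move=> /subsetP ST /andP[S_gt0 S_lt]; apply/and3P; split.
- by rewrite -card_gt0.
- by apply/subsetP=> x /ST; rewrite inE => /andP[].
- by apply/forall_inP=> x /ST; rewrite inE => /andP[_ /eqP->].
Qed.

Lemma card_max_order_cyclic :
  cyclic G -> #|max_order_elements G| = totient #|G|.
Proof.
move=> G_cyclic; have expG := exponent_cyclic G_cyclic.
have [a Ga] := cyclicP G_cyclic; rewrite Ga totient_gen.
apply: eq_card => x; rewrite !inE -Ga expG /generator.
apply/andP/eqP=> [[xG /eqP ox]|Gx]; last first.
  by split; [rewrite Gx cycle_id | rewrite orderE -Gx].
by apply/eqP; rewrite eq_sym eqEcard cycle_subG xG -ox orderE leqnn.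
Qed.

(** The exponent divides the order of the group and is itself the order of an
    element, so it can equal the order of the group only in a cyclic group. *)
Lemma double_exponent_leq_card :
  abelian G -> ~~ cyclic G -> 2 * exponent G <= #|G|.
Proof.
move=> G_abelian; apply: contraR; rewrite -ltnNge => G_small.
have [k Gk] := dvdnP (exponent_dvdn G).
have [x xG ox] := exponent_witness (abelian_nil G_abelian).
have k1 : k = 1.
  have k_lt2 : k < 2 by move: G_small; rewrite Gk ltn_pmul2r ?exponent_gt0.
  by case: k Gk k_lt2 => [|[]] // G0; move: (cardG_gt0 G); rewrite G0.
apply/cyclicP; exists x; apply/eqP; rewrite eq_sym eqEcard cycle_subG xG /=.
by rewrite Gk k1 mul1n ox orderE.
Qed.

(** Translation by an [a] of maximal order injects the complement of the set of
    elements of maximal order into that set: if neither [x] nor [x * a] had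
    maximal order, the power [p ^ l.-1] would kill both, hence also [a]. *)
Lemma leq_card_max_order (p l : nat) :
    prime p -> abelian G -> exponent G = p ^ l ->
  #|G| <= 2 * #|max_order_elements G|.
Proof.
move=> p_prime G_abelian expG; set T := max_order_elements G.
have ord_dvd x : x \in G -> #[x]%g %| p ^ l.
  by move=> xG; rewrite -expG dvdn_exponent.
have [a aG oa] := exponent_witness (abelian_nil G_abelian).
have TG : T \subset G by apply/subsetP=> x; rewrite inE => /andP[].
have shift : [set (x * a)%g | x in G :\: T] \subset T.
  apply/subsetP=> _ /imsetP[x /setDP[xG xT] ->].
  rewrite inE groupM //=; apply: contraTT isT => xa_ord.
  move: xT; rewrite inE xG expG /= => x_ord; rewrite expG in xa_ord.
  have xq := dvdn_pfactor_pred p_prime (ord_dvd _ xG) x_ord.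
  have xaq := dvdn_pfactor_pred p_prime (ord_dvd _ (groupM xG aG)) xa_ord.
  have aq : #[a]%g %| p ^ l.-1.
    move: xq xaq; rewrite !order_dvdn expgMn; last exact: (centsP G_abelian).
    by move=> /eqP->; rewrite mul1g.
  (* [p ^ l] divides [p ^ l.-1] only if [l = 0], when [x] is trivial and
     already has maximal order. *)
  move: aq; rewrite -oa expG dvdn_Pexp2l ?prime_gt1 //.
  case: l {xa_ord xaq xq oa} expG ord_dvd x_ord => [|l] _ ord_dvd x_ord /=.
    by move: (ord_dvd x xG) x_ord; rewrite dvdn1 => ->.
  by rewrite ltnn.
rewrite -(cardsID T G) (setIidPr TG) mul2n -addnn leq_add2l.
by rewrite -(card_imset _ (mulIg a)) subset_leq_card.
Qed.

End ChowlaBounds.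

Theorem theorem3p3 (gT : finGroupType) (G : {group gT}) (p l : nat)
    (p_prime : prime p) (G_abelian : abelian G) (G_pgroup : (p.-group G)%g)
    (G_nontrivial : 1 < #|G|) (G_exponent : exponent G = p ^ l) :
  (cyclic G -> chowla_number G = totient (p ^ l) /\
               totient (p ^ l) = p ^ l - p ^ (l - 1)) /\
  (~~ cyclic G -> chowla_number G = p ^ l - 1).
Proof.
have l_gt0 : 0 < l.
  rewrite lt0n; apply: contraTneq G_nontrivial => l0.
  by rewrite -leqNgt -trivg_card_le1 trivg_exponent G_exponent l0.
have pl_gt1 : 1 < p ^ l by rewrite -(exp1n l) ltn_exp2r ?prime_gt1.
split=> [G_cyclic|G_noncyclic].
  split; last by rewrite subn1 totient_pfactor_sub.
  have cardG : #|G| = p ^ l by rewrite -exponent_cyclic.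
  have cardT : #|max_order_elements G| = totient (p ^ l).
    by rewrite card_max_order_cyclic ?cardG.
  apply/eqP; rewrite eqn_leq; apply/andP; split; last first.
    rewrite -cardT chowla_number_ge // chowla_set_max_order //.
    rewrite cardT G_exponent totient_gt0 expn_gt0 prime_gt0 //=.
    by rewrite totient_pfactor_sub // ltn_subrL !expn_gt0 prime_gt0.
  apply/bigmax_leqP=> S /and3P[_ /subsetP SG /forall_inP ordS].
  rewrite leqNgt; apply/negP=> S_gt.
  have /subsetPn[x xS xT] : ~~ (S \subset max_order_elements G).
    apply: contraL S_gt => /subset_leq_card.
    by rewrite cardT -leqNgt.
  have xG := SG x xS.
  have ox_dvd : #[x]%g %| p ^ l by rewrite -G_exponent dvdn_exponent.
  have ox_neq : #[x]%g != p ^ l by move: xT; rewrite inE xG G_exponent.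
  have ox_le : #[x]%g <= p ^ l.-1.
    by rewrite dvdn_leq ?expn_gt0 ?prime_gt0 ?dvdn_pfactor_pred.
  have tot_ge := leq_pfactor_pred_totient p_prime l_gt0.
  have := leq_trans (ordS x xS) (leq_trans ox_le tot_ge).
  by rewrite ltnNge ltnW.
apply/eqP; rewrite eqn_leq; apply/andP; split.
  apply/bigmax_leqP=> S /chowla_set_ltn_exponent.
  by rewrite G_exponent subn1 => S_lt; rewrite -ltnS prednK // ltnW.
have T_ge : p ^ l - 1 <= #|max_order_elements G|.
  apply: leq_trans (leq_subr 1 _) _.
  rewrite -(leq_pmul2l (isT : 0 < 2)) -G_exponent.
  apply: leq_trans (double_exponent_leq_card G_abelian G_noncyclic) _.
  exact: leq_card_max_order p_prime G_abelian G_exponent.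
have [S ST cardS] := subset_of_card T_ge.
rewrite -cardS chowla_number_ge // chowla_set_max_order //.
by rewrite cardS G_exponent subn_gt0 pl_gt1 ltn_subrL (ltnW pl_gt1).
Qed.
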